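(* Let $N$ distinguishable balls be distributed at random into $M$ urns numbered $1,\dots,M$, so that each of the $M^N$ placements has probability $1/M^N$. Let $X$ be the largest integer $r\in\{0,1,\dots,M\}$ such that for each $k$ with $1\le k\le r$ the total number of balls in urns $1,\dots,k$ is at least $k$ (so $X=0$ if urn $1$ is empty). Then the distribution of $X$ is given by $$P(X=a)=\binom{N}{a}(a+1)^{a-1}\frac{1}{M^a}\left(1-\frac{a+1}{M}\right)^{N-a},\qquad a=0,1,2,\dots,N.$$
   Context: $N$ and $M$ are positive integers. Convention: $0^0=1$.
   Formalization: The formula is proved for all a ≤ N when N ≤ M, and for a < M when N > M; the values M ≤ a ≤ N with N > M are excluded, since the formula fails there (N=2, M=1, a=1: the probability is 1 but the formula gives −2). *)

(* Defs.v *)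
From HB Require Import structures.
From mathcomp Require Import all_boot all_order all_algebra.
Set Implicit Arguments.
Unset Strict Implicit.
Unset Printing Implicit Defensive.
Import Order.TTheory GRing.Theory Num.Theory.
Local Open Scope ring_scope.

(* Balls are elements of 'I_N; the urn numbered j.+1 is the element of 'I_M
   with value j, so that urns 1, ..., k are those with value < k. *)
Definition placement (N M : nat) := {ffun 'I_N -> 'I_M}.

Definition Prob (R : realFieldType) (N M : nat) (E : pred (placement N M)) : R :=
  \sum_(w : placement N M | E w) (M%:R ^+ N)^-1.

Definition balls_upto (N M : nat) (w : placement N M) (k : nat) : nat :=
  #|[set i : 'I_N | (w i < k)%N]|.

Definition admissible (N M : nat) (w : placement N M) (r : nat) : bool :=
  [forall k : 'I_M.+1, (1 <= k <= r)%N ==> (k <= balls_upto w k)%N].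

(* The maximum is over a nonempty set, since r = 0 is always admissible. *)
Definition X (N M : nat) (w : placement N M) : nat :=
  (\max_(r < M.+1 | admissible w r) r)%N.

(* Main.v *)
Require Import Defs.
From mathcomp Require Import all_boot all_order all_algebra ring.
Import Order.TTheory GRing.Theory Num.Theory.
Local Open Scope ring_scope.

(** Call a placement of n balls in M urns parking when urns 1, ..., k hold at
    least k balls for every k <= n.  If a < M, then X = a means that the
    placement is admissible up to a while urns 1, ..., a + 1 hold at most a
    balls: exactly a balls lie in urns 1, ..., a, they form a parking placement
    by themselves, urn a + 1 is empty, and the other N - a balls lie anywhere
    in the last M - a - 1 urns.  Writing P(a) for the number of parking
    placements of a balls, this gives [card_X]:
      #{X = a} = C(N, a) P(a) (M - a - 1)^(N - a).

    It remains to see that P(n) = (n + 1)^(n - 1) for n <= M ([num_parkingE]).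
    With n <= M balls X never exceeds n, and X = n means that the placement is
    parking, so summing over all values of X yields
      P(n) + sum_(a < n) C(n, a) P(a) (M - a - 1)^(n - a) = M^n.
    This determines P(n) from the smaller cases, and (n + 1)^(n - 1) satisfies
    the same recurrence by Abel's binomial identity ([abel_identity]).  Abel's
    identity itself is obtained by expanding each (y - (k + 1))^(n - k) in
    powers of y: the coefficient of y^l is, up to a factor, an (n - l)-th
    finite difference of a polynomial of degree n - l - 1
    ([alternating_binomial_power]).

    The case a = M only arises for N = M, where the exponent N - a is 0 and the
    claim is the formula for P(N). *)

Set Implicit Arguments.
Unset Strict Implicit.

(** * Abel's binomial identity *)

(** The sum is, up to sign, the m-th finite difference of a polynomial of degree
    e < m, hence zero.  Pascal's rule writes it as an (m-1)-th difference of
    (x + k)^e - (x + k + 1)^e, a combination of smaller powers of x + k. *)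
Lemma alternating_binomial_power (R : comNzRingType) (m e : nat) (x : R) :
  (e < m)%N ->
  \sum_(k < m.+1) (-1) ^+ k * 'C(m, k)%:R * (x + k%:R) ^+ e = 0.
Proof.
elim: m e x => // m IH e x; rewrite ltnS => le_em.
have step : \sum_(k < m.+2) (-1) ^+ k * 'C(m.+1, k)%:R * (x + k%:R) ^+ e =
    \sum_(k < m.+1) (-1) ^+ k * 'C(m, k)%:R *
        ((x + k%:R) ^+ e - (x + k%:R + 1) ^+ e).
  rewrite big_ord_recl /= bin0.
  under eq_bigr => k _ do
    rewrite binS natrD mulrDr mulrDl.
  rewrite big_split /= addrA.
  under [in RHS]eq_bigr => k _ do rewrite mulrBr.
  rewrite sumrB; congr (_ + _).
    rewrite [in RHS]big_ord_recl /= bin0; congr (_ + _).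
    rewrite big_ord_recr /= bin_small // mulr0 mul0r addr0.
    by apply: eq_bigr => k _; rewrite /bump.
  rewrite -sumrN; apply: eq_bigr => k _.
  by rewrite /bump /= add1n exprS mulN1r !mulNr -addrA -natr1.
rewrite step.
under eq_bigr => k _ do
  rewrite (exprDn (x + k%:R) 1) big_ord_recl /= mulr1 bin0 mulr1n subn0
    opprD addrA subrr add0r -sumrN mulr_sumr.
rewrite exchange_big /= big1 // => i _.
under eq_bigr => k _ do rewrite expr1n mulr1 mulrN -(mulr_natr (_ ^+ _)) mulrA.
have lt_im : (e - bump 0 i < m)%N.
  by rewrite /bump /= add1n; apply: leq_trans le_em;
    rewrite -subSn // subSS leq_subr.
by rewrite sumrN -mulr_suml IH // mul0r oppr0.
Qed.

(** Both sides are the trinomial coefficient n! / (k! l! (n - k - l)!), or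
    vanish when k + l > n. *)
Lemma bin_mul_exchange (n k l : nat) :
  ('C(n, k) * 'C(n - k, l) = 'C(n, l) * 'C(n - l, k))%N.
Proof.
have vanish i j : (n < i + j)%N -> ('C(n, i) * 'C(n - i, j) = 0)%N.
  have [le_in lt_n|lt_ni _] := leqP i n; last by rewrite bin_small.
  by rewrite (@bin_small (n - i) j) ?muln0 // ltn_subLR.
have [le_kl|lt_n] := leqP (k + l) n; last by rewrite !vanish // addnC.
have le_k : (k <= n)%N by apply: leq_trans le_kl; apply: leq_addr.
have le_l : (l <= n)%N by apply: leq_trans le_kl; apply: leq_addl.
have le_l' : (l <= n - k)%N by rewrite leq_subRL.
have le_k' : (k <= n - l)%N by rewrite leq_subRL // addnC.
apply/eqP; rewrite -(eqn_pmul2r (fact_gt0 k)) -(eqn_pmul2r (fact_gt0 l)).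
rewrite -(eqn_pmul2r (fact_gt0 (n - k - l))).
have e1 := bin_fact le_k; have e2 := bin_fact le_l'.
have e3 := bin_fact le_l; have e4 := bin_fact le_k'.
rewrite subnAC in e4.
apply/eqP.
transitivity n`!.
  by rewrite -e1 -e2 -!mulnA; congr (_ * _)%N; rewrite mulnCA.
rewrite -e3 -e4 -!mulnA; congr (_ * _)%N.
by rewrite mulnCA; congr (_ * _)%N; rewrite mulnCA.
Qed.

(** The summation range does not depend on m, so that binomial expansions with
    different exponents can be summed power by power. *)
Lemma exprDn_widen (R : comNzRingType) (x y : R) (m n : nat) : (m <= n)%N ->
  (x + y) ^+ m = \sum_(l < n.+1) 'C(m, l)%:R * (x ^+ l * y ^+ (m - l)).
Proof.
move=> le_mn; rewrite addrC exprDn.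
rewrite (big_ord_widen n.+1
  (fun i => y ^+ (m - i) * x ^+ i *+ 'C(m, i))) ?ltnS //.
rewrite big_mkcond; apply: eq_bigr => l _; rewrite ltnS.
have [_|lt_ml] := leqP; first by rewrite mulr_natl mulrC.
by rewrite bin_small // mul0r.
Qed.

(** With z = y - 1, this is Abel's
      sum_k C(n, k) x (x + k)^(k - 1) (z - k)^(n - k) = (x + z)^n
    at x = 1, where the truncated exponent k.-1 is harmless at k = 0 since its
    base is then 1. *)
Lemma abel_identity (R : comNzRingType) (n : nat) (y : R) :
  \sum_(k < n.+1) 'C(n, k)%:R * k.+1%:R ^+ k.-1 * (y - k.+1%:R) ^+ (n - k)
    = y ^+ n.
Proof.
under eq_bigr => k _ do
  rewrite (exprDn_widen y _ (leq_subr k n)) mulr_sumr.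
(* Only the coefficient of y^n, which comes from k = 0, survives. *)
rewrite exchange_big /= (bigD1 ord_max) //= [X in _ + X]big1 ?addr0 => [|l].
  rewrite (bigD1 ord0) //= big1 ?addr0 => [|k].
    by rewrite subn0 !binn subnn bin0 !expr0 !mul1r mulr1.
  rewrite -val_eqE /= -lt0n => k_gt0.
  rewrite (@bin_small (n - k) n) ?mul0r ?mulr0 //.
  by rewrite ltn_subrL k_gt0 (leq_trans k_gt0) // -ltnS ltn_ord.
rewrite -val_eqE /= => l_neq_n.
have lt_ln : (l < n)%N by rewrite ltn_neqAle l_neq_n -ltnS ltn_ord.
have lt_e : ((n - l).-1 < n - l)%N by rewrite ltn_predL subn_gt0.
(* The coefficient of y^l is a multiple of the alternating sum for m = n - l,
   e = n - l - 1, x = 1. *)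
transitivity ('C(n, l)%:R * y ^+ l * (-1) ^+ (n - l) *
    \sum_(k < (n - l).+1) (-1) ^+ k * 'C(n - l, k)%:R
      * (1 + k%:R) ^+ (n - l).-1); last first.
  by rewrite alternating_binomial_power // mulr0.
rewrite (big_ord_widen n.+1 (fun k => (-1) ^+ k * 'C(n - l, k)%:R
   * (1 + k%:R) ^+ (n - l).-1)) ?ltnS ?leq_subr //.
rewrite [in RHS]big_mkcond mulr_sumr; apply: eq_bigr => k _; rewrite ltnS.
rewrite !mulrA -[_ * _ * 'C(n - k, l)%:R]mulrAC -natrM bin_mul_exchange natrM.
have [le_kl|lt_k] := leqP; last first.
  by rewrite (@bin_small (n - l) k) // !(mulr0, mul0r).
have sgn : (-1) ^+ (n - l) * (-1) ^+ k = (-1) ^+ (n - k - l) :> R.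
  by rewrite subnAC -exprD -[in LHS](subnK le_kl) -addnA addnn exprD -mul2n
    exprM sqrrN expr1n expr1n mulr1.
have pw : k.+1%:R ^+ k.-1 * k.+1%:R ^+ (n - k - l) =
    (1 + k%:R) ^+ (n - l).-1 :> R.
  rewrite nat1r; have [->|k_gt0] := posnP k; first by rewrite !expr1n mulr1.
  by rewrite -exprD subnAC; congr (_ ^+ _);
    rewrite -!subn1 addnC addnBA // subnK.
rewrite (exprNn k.+1%:R) -sgn -pw.
ring.
Qed.

(** * The event X = a *)

Lemma balls_upto_le (N M : nat) (w : placement N M) (k : nat) :
  (balls_upto w k <= N)%N.
Proof. by rewrite -[X in (_ <= X)%N](card_ord N); apply: max_card. Qed.

Lemma admissibleP (N M : nat) (w : placement N M) (r : nat) : (r <= M)%N ->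
  reflect (forall k, (k <= r)%N -> (k <= balls_upto w k)%N) (admissible w r).
Proof.
move=> le_rM; apply: (iffP forallP) => [adm k le_kr | adm k].
  have [-> //|k_gt0] := posnP k.
  have lt_kM : (k < M.+1)%N by rewrite ltnS (leq_trans le_kr).
  by have /implyP := adm (Ordinal lt_kM); apply; rewrite k_gt0.
by apply/implyP => /andP[_ /adm].
Qed.

Lemma admissible0 (N M : nat) (w : placement N M) : admissible w 0.
Proof. by apply/admissibleP => // k; rewrite leqn0 => /eqP ->. Qed.

Lemma admissible_down (N M : nat) (w : placement N M) (r s : nat) :
  (s <= r)%N -> (r <= M)%N -> admissible w r -> admissible w s.
Proof.
move=> le_sr le_rM /(admissibleP _ le_rM) adm.
apply/admissibleP; first exact: leq_trans le_rM.
by move=> k le_ks; apply: adm; apply: leq_trans le_sr.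
Qed.

Lemma leq_X (N M : nat) (w : placement N M) (r : nat) : (r <= M)%N ->
  (r <= X w)%N = admissible w r.
Proof.
move=> le_rM; apply/idP/idP => [|adm]; last first.
  have lt_rM : (r < M.+1)%N by [].
  exact: (@leq_bigmax_cond _ (fun s : 'I_M.+1 => admissible w s)
           (fun s : 'I_M.+1 => s : nat) (Ordinal lt_rM)).
apply: contraTT => nadm; rewrite -ltnNge.
case: r le_rM nadm => [_|r le_rM nadm]; first by rewrite admissible0.
rewrite ltnS; apply/bigmax_leqP => s adm.
rewrite leqNgt; apply: contra nadm => lt_rs.
by apply: admissible_down adm; rewrite // -ltnS ltn_ord.
Qed.

Lemma X_le (N M : nat) (w : placement N M) : (X w <= M)%N.
Proof. by apply/bigmax_leqP => s _; rewrite -ltnS ltn_ord. Qed.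

Lemma X_le_balls (N M : nat) (w : placement N M) : (X w <= N)%N.
Proof.
have /(admissibleP _ (X_le w)) adm : admissible w (X w).
  by rewrite -leq_X ?X_le.
exact: leq_trans (adm _ (leqnn _)) (balls_upto_le _ _).
Qed.

Definition low (N M : nat) (w : placement N M) (k : nat) : {set 'I_N} :=
  [set i : 'I_N | (w i < k)%N].

(** Admissibility up to a already puts a balls in urns 1, ..., a; failing at
    a + 1 then leaves no room for any further ball in urns 1, ..., a + 1. *)
Lemma X_eqE (N M : nat) (w : placement N M) (a : nat) : (a < M)%N ->
  (X w == a) = [&& admissible w a, low w a.+1 == low w a & #|low w a| == a].
Proof.
move=> lt_aM; have le_aM := ltnW lt_aM.
have sub : low w a \subset low w a.+1.
  by apply/subsetP => i; rewrite !inE => /leqW.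
have -> : (X w == a) = admissible w a && ~~ admissible w a.+1.
  by rewrite -!leq_X // -ltnNge ltnS eqn_leq andbC.
apply: andb_id2l => adm; have /(admissibleP _ le_aM) adm' := adm.
have ge_a : (a <= #|low w a|)%N by exact: adm'.
apply/idP/idP => [nadm|/andP[/eqP eqlow /eqP card]].
  have le_a : (#|low w a.+1| <= a)%N.
    rewrite leqNgt; apply: contra nadm => gt_a; apply/admissibleP => // k.
    by rewrite leq_eqVlt => /predU1P[->|/adm'].
  rewrite eq_sym eqEcard sub (leq_trans le_a) //= eqn_leq ge_a andbT.
  exact: leq_trans (subset_leq_card sub) le_a.
apply/negP => /(admissibleP _ lt_aM)/(_ _ (leqnn _)).
by rewrite /balls_upto -/(low w a.+1) eqlow card ltnn.
Qed.

(** * Counting by the set of balls in the first urns *)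

(** For n <= M these are the parking functions of length n: the condition at
    n puts every ball in the first n urns, so the count does not depend on M.
    Keeping M urns as codomain makes restriction to a set of balls a map
    between placements with the same urns. *)
Definition num_parking (n M : nat) : nat :=
  #|[set u : placement n M | admissible u n]|.

(** Once the set S of balls in the first #|S| urns is prescribed, restriction to
    S and to its complement identifies these placements with the pairs of a
    parking placement of S and an arbitrary map from the complement to the urns
    beyond urn #|S| + 1. *)
Lemma card_X_fiber (N M : nat) (S : {set 'I_N}) : (#|S| < M)%N ->
  #|[set w : placement N M | (X w == #|S|) && (low w #|S| == S)]| =
    (num_parking #|S| M * (M - #|S|.+1) ^ (N - #|S|))%N.
Proof.
set a := #|S|; move=> lt_aM.
pose inside (w : placement N M) : placement a M := [ffun x => w (enum_val x)].
pose outside (w : placement N M) : {ffun 'I_#|~: S| -> 'I_M} :=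
  [ffun y => w (enum_val y)].
pose high := [set j : 'I_M | (a < j)%N].
have card_high : #|high| = (M - a.+1)%N.
  rewrite -sum1_card -[RHS]muln1 -sum_nat_const_nat big_geq_mkord.
  by apply: eq_bigl => j; rewrite inE.
pose B := [set v : {ffun 'I_#|~: S| -> 'I_M} | v \in ffun_on high].
have card_B : #|B| = ((M - a.+1) ^ (N - a))%N.
  by rewrite cardsE card_ffun_on card_high card_ord cardsCs setCK card_ord.
rewrite /num_parking -card_B -cardsX.
rewrite -(card_in_imset (f := fun w => (inside w, outside w))); last first.
  move=> w1 w2 _ _ [/ffunP eq_in /ffunP eq_out]; apply/ffunP => i.
  have [iS|iS] := boolP (i \in S).
    by have := eq_in (enum_rank_in iS i); rewrite !ffunE enum_rankK_in.
  have iC : i \in ~: S by rewrite inE.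
  by have := eq_out (enum_rank_in iC i); rewrite !ffunE enum_rankK_in.
have balls_inside w k : low w k \subset S ->
    balls_upto (inside w) k = balls_upto w k.
  move=> sub; rewrite /balls_upto -(card_imset _ enum_val_inj).
  apply: eq_card => i; rewrite inE; apply/imsetP/idP => [[x]|lt_wi].
    by rewrite inE ffunE => ? ->.
  have iS : i \in S by apply: (subsetP sub); rewrite inE.
  by exists (enum_rank_in iS i); rewrite ?inE ?ffunE enum_rankK_in.
apply: eq_card => -[u v]; rewrite in_setX !inE /=.
apply/imsetP/andP => [[w]|].
  rewrite inE X_eqE // => /andP[/and3P[adm /eqP eqlow _] /eqP lowS] [-> ->].
  have le_aM := ltnW lt_aM; split.
    apply/admissibleP => // k le_ka; rewrite balls_inside.
      by move: k le_ka; apply/admissibleP.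
    by rewrite -lowS; apply/subsetP => i; rewrite !inE => /leq_trans; apply.
  apply/ffun_onP => y; rewrite ffunE inE ltnNge; apply/negP => le_wa.
  have wS : enum_val y \in low w a by rewrite -eqlow inE.
  by rewrite lowS in wS; have := enum_valP y; rewrite inE wS.
move=> [adm /ffun_onP onv].
have memC i : i \notin S -> i \in ~: S by rewrite inE.
(* The index functions need a proof of membership, hence a test that returns
   one. *)
pose w : placement N M := [ffun i =>
  match decP (@idP (i \in S)) with
  | left h => u (enum_rank_in h i)
  | right h => v (enum_rank_in (memC i (introN idP h)) i)
  end].
have inw : inside w = u.
  apply/ffunP => x; rewrite !ffunE; case: decP => h.
    by rewrite enum_valK_in.
  by case: h; apply: enum_valP.
have outw : outside w = v.
  apply/ffunP => y; rewrite !ffunE; case: decP => h.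
    by have := enum_valP y; rewrite inE h.
  by rewrite enum_valK_in.
have wS i : i \in S -> (w i < a)%N.
  move=> iS; rewrite -[i](enum_rankK_in iS) //.
  have /ffunP/(_ (enum_rank_in iS i)) := inw; rewrite ffunE => ->.
  (* The parking condition for k = a accounts for all the a balls of u. *)
  have lowu : low u a = setT.
    apply/eqP; rewrite eqEcard subsetT cardsT card_ord.
    by move/(admissibleP _ (ltnW lt_aM)): adm; apply.
  by have := in_setT (enum_rank_in iS i); rewrite -lowu inE.
have wSC i : i \notin S -> (a < w i)%N.
  move=> iS; have iC := memC i iS.
  rewrite -[i](enum_rankK_in iC) //.
  have /ffunP/(_ (enum_rank_in iC i)) := outw; rewrite ffunE => ->.
  by have := onv (enum_rank_in iC i); rewrite inE.
have lowa : low w a = S.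
  apply/setP => i; rewrite inE; have [/wS //|/wSC] := boolP (i \in S).
  by move=> lt_aw; apply/negbTE; rewrite -leqNgt ltnW.
have lowa1 : low w a.+1 = S.
  apply/setP => i; rewrite inE; have [/wS/leqW //|/wSC] := boolP (i \in S).
  by move=> lt_aw; apply/negbTE; rewrite -leqNgt.
exists w; last by rewrite inw outw.
rewrite inE X_eqE // lowa lowa1 !eqxx !andbT.
apply/admissibleP => [|k le_ka]; first exact: ltnW.
rewrite -balls_inside ?inw.
  by move: k le_ka; apply/admissibleP; first exact: ltnW.
by rewrite -lowa; apply/subsetP => i; rewrite !inE => /leq_trans; apply.
Qed.

Lemma card_X (N M a : nat) : (a < M)%N ->
  #|[set w : placement N M | X w == a]| =
    ('C(N, a) * (num_parking a M * (M - a.+1) ^ (N - a)))%N.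
Proof.
move=> lt_aM; rewrite -sum1_card.
rewrite (partition_big (fun w => low w a) (fun S => #|S| == a)) /=; last first.
  by move=> w; rewrite inE X_eqE // => /and3P[].
rewrite -[N in 'C(N, a)]card_ord -card_draws -sum1_card big_distrl /=.
rewrite [RHS](eq_bigl (fun S : {set 'I_N} => #|S| == a)) => [|S]; last first.
  by rewrite inE.
apply: eq_bigr => S /eqP cardS; rewrite mul1n -cardS -card_X_fiber ?cardS //.
by rewrite -sum1_card; apply: eq_bigl => w; rewrite !inE.
Qed.

(** * The number of parking placements *)

(** The events X = a for a <= n partition the M^n placements; the terms with
    a < n are known by induction, and Abel's identity at y = M has the same
    terms for a < n and the same total. *)
Lemma num_parkingE (n M : nat) : (n <= M)%N ->
  num_parking n M = (n.+1 ^ n.-1)%N.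
Proof.
elim/ltn_ind: n => n IH le_nM.
have total : (\sum_(a < n.+1) #|[set w : placement n M | X w == a]| = M ^ n)%N.
  rewrite -[n in (M ^ n)%N]card_ord -[M in (M ^ _)%N]card_ord -card_ffun.
  rewrite -sum1_card.
  rewrite
    (partition_big (fun w : placement n M => inord (X w) : 'I_n.+1) xpredT) //=.
  apply: eq_bigr => a _; rewrite -sum1_card; apply: eq_bigl => w.
  by rewrite inE -val_eqE /= inordK // ltnS X_le_balls.
(* Abel's sum has a term for a = n, where M - (n + 1) may be negative; hence
   the passage to the integers. *)
have := abel_identity n (M%:R : int).
rewrite -natrX -total natr_sum !big_ord_recr /= subnn expr0 binn mul1r mulr1.
have -> : [set w : placement n M | X w == n] = [set u | admissible u n].
  by apply/setP => w; rewrite !inE -leq_X // eqn_leq X_le_balls.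
rewrite -/(num_parking n M).
rewrite (eq_bigr (fun a : 'I_n => #|[set w : placement n M | X w == a]|%:R)).
  by move/addrI; rewrite -natrX; move/eqP; rewrite eqr_nat => /eqP.
move=> a _; have lt_aM := leq_trans (ltn_ord a) le_nM.
by rewrite card_X // IH // ?(ltnW lt_aM) // !natrM !natrX natrB // mulrA.
Qed.

(** * The distribution of X *)

Theorem lemma3p2 (R : realFieldType) (N M : nat) (hN : (0 < N)%N) (hM : (0 < M)%N)
    (a : nat) (ha : (a <= N)%N) (haM : (N <= M)%N \/ (a < M)%N) :
  Prob R (fun w : placement N M => X w == a) =
    'C(N, a)%:R * (a.+1)%:R ^ (a%:Z - 1) * (1 / M%:R ^+ a)
      * (1 - (a.+1)%:R / M%:R) ^+ (N - a).
Proof.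
have M_neq0 : M%:R != 0 :> R by rewrite pnatr_eq0 -lt0n.
have count : #|[set w : placement N M | X w == a]| =
    ('C(N, a) * (a.+1 ^ a.-1 * (M - a.+1) ^ (N - a)))%N.
  have [lt_aM|le_Ma] := ltnP a M.
    by rewrite card_X // num_parkingE // ltnW.
  have le_NM : (N <= M)%N by case: haM => // /leq_trans/(_ le_Ma); rewrite ltnn.
  have eq_aN : a = N by apply/eqP; rewrite eqn_leq ha (leq_trans le_NM).
  rewrite eq_aN binn subnn expn0 muln1 mul1n -(num_parkingE le_NM).
  by apply: eq_card => w; rewrite !inE -leq_X // eqn_leq X_le_balls.
have pow : (a.+1)%:R ^ (a%:Z - 1) = (a.+1 ^ a.-1)%:R :> R.
  case: (a) => [|b]; first by rewrite exp1rz.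
  have -> : b.+1%:Z - 1 = b by rewrite -addn1 PoszD addrK.
  by rewrite natrX.
rewrite /Prob (eq_bigl (fun w => w \in [set w : placement N M | X w == a]));
  last by move=> w; rewrite inE.
rewrite sumr_const count pow -(mulr_natl (_^-1)) !natrM -!mulrA.
congr (_ * (_ * _)).
rewrite mul1r -[N in _ ^+ N](subnKC ha) exprD invfM mulrCA; congr (_ * _).
rewrite -exprVn natrX -exprMn.
have [lt_aM|le_Ma] := ltnP a M.
  by rewrite natrB // mulrBl divff.
have -> : (N - a = 0)%N.
  apply/eqP; rewrite subn_eq0; case: haM => [/leq_trans|]; first exact.
  by rewrite ltnNge le_Ma.
by rewrite !expr0.
Qed.
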